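(* Let $(W,S)$ be a Coxeter system with $S$ finite, and let $T\subset S$ be such that for any $t\in T$ and $s\in S-T$ the exponent $m_{st}$ is even or $\infty$, and such that $W_{S-T}$ is finite. Let $\varphi\colon S\to I$ be an allowable partition with $\varphi^{-1}(x_0)=S-T$ for some $x_0\in I$. Let $\overline{W_T}$ be the normal closure of $W_T$ in $W$, which is a Coxeter group with generating set $S_T=\{wtw^{-1}: t\in T,\ w\in W_{S-T}\}$, and let $\varphi_T\colon S_T\to I$ be the (well defined, allowable) function $\varphi_T(wtw^{-1})=\varphi(t)$ for $t\in T$, $w\in W_{S-T}$. Then $$W_\varphi(\mathbf{x})_{|x_0=1}=(\# W_{S-T})\cdot\left(\overline{W_T}\right)_{\varphi_T}(\mathbf{x}),$$ where $W_\varphi$ is the multi-variable growth series of $(W,S)$ and $(\overline{W_T})_{\varphi_T}$ is that of $(\overline{W_T},S_T)$.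
   Context: A Coxeter system $(W,S)$ is a group $W$ with a generating set $S$ and presentation $W=\langle S\mid (st)^{m_{st}}=1 \text{ for all } s,t\in S\rangle$, where $m_{ss}=1$ and $m_{st}=m_{ts}\in\{2,3,\dots,\infty\}$ for $s\ne t$ ($m_{st}=\infty$ means no relation). For $U\subset S$, $W_U$ is the subgroup generated by $U$. For a Coxeter system $(W,S)$, a function $\varphi\colon S\to I$ to a set $I$ of indeterminates is an allowable partition if $\varphi(s)=\varphi(s')$ whenever $s,s'\in S$ are conjugate in $W$. For $S_0\subset S$ closed under conjugacy among generators (every generator conjugate to an element of $S_0$ lies in $S_0$), $\ell_{S_0}(w)$ is the number, counted with multiplicity, of generators from $S_0$ appearing in a reduced word for $w$; it does not depend on the reduced word. Set $w_\varphi(\mathbf{x})=\prod_{x\in I}x^{\ell_{\varphi^{-1}(x)}(w)}$, $\mathbf{x}=(x)_{x\in I}$. The multi-variable growth series of $W$ is the formal power series $W_\varphi(\mathbf{x})=\sum_{w\in W}w_\varphi(\mathbf{x})$. The same definitions apply to the Coxeter system $(\overline{W_T},S_T)$ with $\varphi_T$. For each monomial $J$ in the variables other than $x_0$, only finitely many monomials $Jx_0^m$ occur in $W_\varphi$ with nonzero coefficient, so the substitution $x_0=1$ makes sense. *)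

(* Defs.v *)
From HB Require Import structures.
From mathcomp Require Import all_boot all_order all_algebra.
From mathcomp Require Import finmap all_classical.
From mathcomp Require Import monalg.

Set Implicit Arguments.
Unset Strict Implicit.
Unset Printing Implicit Defensive.

Import GRing.Theory.
Local Open Scope classical_set_scope.
Local Open Scope ring_scope.

Definition is_subgroup (W : groupType) (H : set W) : Prop :=
  group_closed (mem H).

Definition is_normal_subgroup (W : groupType) (H : set W) : Prop :=
  is_subgroup H /\ forall x g : W, H x -> H (x ^ g)%g.

Definition subgroup_gen (W : groupType) (A : set W) : set W :=
  smallest (@is_subgroup W) A.

Definition normal_closure (W : groupType) (A : set W) : set W :=
  smallest (@is_normal_subgroup W) A.

(** A letter [(x, false)] stands for the generator [x], and [(x, true)] for its
   formal inverse.  [pres_eq R u v] says that the words [u] and [v] are equal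
   in the quotient of the free group on [X] by the normal closure of [R]. *)

Inductive pres_eq (X : Type) (R : set (seq (X * bool))) :
    seq (X * bool) -> seq (X * bool) -> Prop :=
| pres_refl u : pres_eq R u u
| pres_sym u v : pres_eq R u v -> pres_eq R v u
| pres_trans u v w : pres_eq R u v -> pres_eq R v w -> pres_eq R u w
| pres_cancel u v x b : pres_eq R (u ++ [:: (x, b); (x, ~~ b)] ++ v) (u ++ v)
| pres_relator u v r : R r -> pres_eq R (u ++ r ++ v) (u ++ v).

Definition word_value (W : groupType) (S : set W) (u : seq (S * bool)) : W :=
  (\prod_(a <- u) (if a.2 then (set_val a.1)^-1 else set_val a.1))%g.

Definition has_presentation (W : groupType) (H S : set W)
    (R : set (seq (S * bool))) : Prop :=
  range (@word_value W S) = H /\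
  forall u v : seq (S * bool), word_value u = word_value v <-> pres_eq R u v.

(** As for finite groups, the group is a subgroup [H] of an ambient group [W]
   (all of [W] being the case [H = setT]).  The exponents [m s t] matter only
   for [s] and [t] in [S]; [None] stands for infinity. *)

Definition coxeter_matrix (W : groupType) (S : set W)
    (m : W -> W -> option nat) : Prop :=
  forall s t, S s -> S t ->
    [/\ m s s = Some 1%N,
        m s t = m t s &
        s <> t -> if m s t is Some k then (2 <= k)%N else true].

Definition coxeter_relators (W : groupType) (S : set W)
    (m : W -> W -> option nat) : set (seq (S * bool)) :=
  [set r | exists (s t : S) (k : nat), m (set_val s) (set_val t) = Some k /\
     r = flatten (nseq k [:: (s, false); (t, false)])].

Definition coxeter_system (W : groupType) (H S : set W)
    (m : W -> W -> option nat) : Prop :=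
  coxeter_matrix S m /\ has_presentation H (coxeter_relators (S := S) m).

Definition even_or_infinite (e : option nat) : bool :=
  if e is Some k then ~~ odd k else true.

(** Values of [phi] outside [S] are irrelevant here and below. *)
Definition allowable (W : groupType) (H S : set W) (I : Type) (phi : W -> I) :
    Prop :=
  forall s s', S s -> S s' -> (exists2 g, H g & s' = (s ^ g)%g) ->
    phi s = phi s'.

(** Generators of a Coxeter system are involutions, so words need no formal
   inverses here. *)
Definition spells (W : groupType) (S : set W) (w : W) (u : seq W) : Prop :=
  (forall s, s \in u -> S s) /\ (\prod_(s <- u) s)%g = w.

Definition reduced_word (W : groupType) (S : set W) (w : W) (u : seq W) :
    Prop :=
  spells S w u /\ forall v, spells S w v -> (size u <= size v)%N.

(** The length is read off a reduced word picked by choice.  For a Coxeter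
   system, and [S0] closed under conjugacy among generators, all reduced words
   give the same value. *)
Definition partial_length (W : groupType) (S S0 : set W) (w : W) : nat :=
  count (fun s => s \in S0) (xget [::] [set u | reduced_word S w u]).

Definition monomial_of (W : groupType) (S : set W) (I : choiceType)
    (phi : W -> I) (w : W) : {cmonom I} :=
  \big[mmul/mone]_(x \in [set: I])
    expcmn (ucm x) (partial_length S (S `&` phi @^-1` [set x]) w).

(** A formal power series with integer coefficients is the function sending a
   monomial to its coefficient. *)
Definition fpseries (I : choiceType) : Type := {cmonom I} -> int.

(** The sum has finitely many nonzero terms when [S] is finite and generates
   [H]. *)
Definition growth_series (W : groupType) (H S : set W) (I : choiceType)
    (phi : W -> I) : fpseries I :=
  fun J => \sum_(w \in H) ((monomial_of S phi w == J)%:R : int).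

Definition evaluable_at1 (I : choiceType) (x0 : I) (F : fpseries I) : Prop :=
  forall J : {cmonom I}, J x0 = 0%N ->
    finite_set [set n : nat | F (mmul J (expcmn (ucm x0) n)) != 0].

(** Substitution of 1 for [x0]; the result does not involve [x0].  It is
   meaningful only if [evaluable_at1 x0 F], since a finitely supported sum
   over an infinite support is 0. *)
Definition eval_at1 (I : choiceType) (x0 : I) (F : fpseries I) : fpseries I :=
  fun J => if J x0 == 0%N
           then \sum_(n \in [set: nat]) F (mmul J (expcmn (ucm x0) n))
           else 0.

Definition conj_generators (W : groupType) (S T : set W) : set W :=
  [set (w * t * w^-1)%g | t in T & w in subgroup_gen (S `\` T)].

Definition extends_by_conjugation (W : groupType) (S T : set W) (I : Type)
    (phi phiT : W -> I) : Prop :=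
  forall t w, T t -> subgroup_gen (S `\` T) w ->
    phiT (w * t * w^-1)%g = phi t.

(* Main.v *)
Require Import Defs.
From mathcomp Require Import all_boot all_order all_algebra.
From mathcomp Require Import finmap all_classical.
From mathcomp Require Import monalg.

Local Open Scope classical_set_scope.
Local Open Scope ring_scope.

(** Let [U] be the subgroup generated by [S \ T].

   The inversions of a word [s_1 .. s_n] are the reflections
   [s_1 .. s_i .. s_1^-1]. Call a set [X] of involutions even if, in every word
   in [X] of value 1, each reflection occurs an even number of times among the
   inversions. This property characterizes Coxeter systems. It follows from the
   presentation because a relator [(s t)^k] has the inversions
   [(s t)^i s] for [i < 2k], each one repeated after [k] steps
   ([coxeter_even_inversions]). Conversely, if [X] is even, a word with a
   repeated inversion can be shortened by two letters, and every relation is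
   then reduced by induction on its length to an alternating one
   ([coxeter_system_of_even_inversions]).

   As the exponents between [T] and [S \ T] are even or infinite, there is a
   retraction [f] of [W] onto [U] that kills [T] ([retraction_exists]). The
   normal closure of [T] is generated by the conjugates [S_T], it is killed by
   [f], and every element of [W] is uniquely a product [h u] with [h] in the
   closure and [u] in [U]. A reflection of [W] is conjugate to an element of
   [T] if and only if [f] kills it. Every word in [S_T] can be spelled out in
   [S] and every word in [S] can be projected to a word in [S_T], and in both
   cases the inversions in [S_T] are the inversions in [S] that [f] kills
   ([spell_out], [project_word]). The first fact makes [S_T] even, hence a
   Coxeter system.

   For the growth series, a word whose inversions are pairwise distinct has the
   same inversions as every reduced word of the same value, and [phi] is
   constant on conjugacy classes, so the monomial of an element can be read off
   any such word ([monomial_ofE]). The projection of a reduced word of [h u] is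
   such a word for [h], and it is obtained by deleting the letters in [S \ T],
   of weight [x0]; so [h u] and [h] have the same monomial up to powers of [x0]
   ([monomial_split]). After the substitution [x0 = 1] the elements [h u], for
   [h] fixed, all contribute the monomial of [h], and there are [#|U|] of
   them. *)

(** * Words and their inversions *)

Section Inversions.
Set Implicit Arguments.
Unset Strict Implicit.
Local Open Scope group_scope.

Definition lconj (W : groupType) (g r : W) : W := g * r * g^-1.

Definition wprod (W : groupType) (u : seq W) : W := \prod_(s <- u) s.

(** For a reduced word of [w] in a Coxeter system, these are the reflections [r]
   such that [r * w] is shorter than [w]. *)
Fixpoint inversions (W : groupType) (u : seq W) : seq W :=
  if u is s :: v then s :: map (lconj s) (inversions v) else [::].

Definition word_in (W : groupType) (X : set W) (u : seq W) : Prop :=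
  forall s, s \in u -> X s.

(** The multiplicities modulo 2 of the inversions form a cocycle on words; it is
   well defined on group elements when it vanishes on the words of value 1. *)
Definition even_inversions (W : groupType) (X : set W) : Prop :=
  forall u, word_in X u -> wprod u = 1 ->
  forall r, ~~ odd (count_mem r (inversions u)).

Definition involutions (W : groupType) (X : set W) : Prop :=
  forall x, X x -> x * x = 1.

Definition products (W : groupType) (X : set W) : set W :=
  [set w | exists2 u, word_in X u & wprod u = w].

Variable W : groupType.
Implicit Types (u v : seq W) (X : set W) (g h r s : W).

Lemma lconjM g h r : lconj (g * h) r = lconj g (lconj h r).
Proof. by rewrite /lconj invgM !mulgA. Qed.

Lemma lconj1 r : lconj 1 r = r.
Proof. by rewrite /lconj invg1 mulg1 mul1g. Qed.

Lemma conjg_lconj r g : r ^ g = lconj g^-1 r.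
Proof. by rewrite /lconj invgK conjgE mulgA. Qed.

Lemma lconjK g : cancel (lconj g) (lconj g^-1).
Proof. by move=> r; rewrite -lconjM mulVg lconj1. Qed.

Lemma lconjVK g : cancel (lconj g^-1) (lconj g).
Proof. by move=> r; rewrite -lconjM mulgV lconj1. Qed.

Lemma lconj_inj g : injective (lconj g).
Proof. exact: can_inj (lconjK g). Qed.

Lemma lconj_eq1 g r : (lconj g r == 1) = (r == 1).
Proof.
have g1 : lconj g 1 = 1 by rewrite /lconj mulg1 mulgV.
by rewrite -[in LHS]g1 (inj_eq (@lconj_inj g)).
Qed.

Lemma lconjMr g r s : lconj g (r * s) = lconj g r * lconj g s.
Proof. by rewrite /lconj !mulgA mulgVK. Qed.

Lemma wprod_nil : wprod [::] = 1 :> W. Proof. exact: big_nil. Qed.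

Lemma wprod_cons s u : wprod (s :: u) = s * wprod u.
Proof. exact: big_cons. Qed.

Lemma wprod_cat u v : wprod (u ++ v) = wprod u * wprod v.
Proof. exact: big_cat. Qed.

Lemma wprod_seq1 s : wprod [:: s] = s. Proof. exact: big_seq1. Qed.

Lemma word_in_cons X s u : word_in X (s :: u) <-> X s /\ word_in X u.
Proof.
split=> [Xu|[Xs Xu] t].
  by split=> [|t tu]; apply: Xu; rewrite inE ?eqxx // tu orbT.
by rewrite inE => /predU1P[->|/Xu].
Qed.

Lemma word_in_cat X u v : word_in X (u ++ v) <-> word_in X u /\ word_in X v.
Proof.
split=> [Xuv|[Xu Xv] t]; last by rewrite mem_cat => /orP[/Xu|/Xv].
by split=> t tu; apply: Xuv; rewrite mem_cat tu ?orbT.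
Qed.

Lemma word_in_rev X u : word_in X (rev u) <-> word_in X u.
Proof. by split=> Xu s su; apply: Xu; rewrite ?mem_rev // -mem_rev. Qed.

Lemma wprod_rev X u : involutions X -> word_in X u ->
  wprod (rev u) = (wprod u)^-1.
Proof.
move=> invX; elim: u => [|s u IH]; first by rewrite wprod_nil invg1.
move=> /word_in_cons[Xs /IH {}IH]; rewrite rev_cons -cats1 wprod_cat wprod_seq1.
by rewrite wprod_cons IH invgM (mulg1_eq (invX _ Xs)).
Qed.

Lemma size_inversions u : size (inversions u) = size u.
Proof. by elim: u => //= s u IH; rewrite size_map IH. Qed.

Lemma inversions_cat u v :
  inversions (u ++ v) = inversions u ++ map (lconj (wprod u)) (inversions v).
Proof.
elim: u => [|s u IH] /=.
  by rewrite wprod_nil -[LHS]map_id; apply: eq_map => r; rewrite lconj1.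
rewrite IH map_cat -map_comp wprod_cons; congr (_ :: _ ++ _).
by apply: eq_map => r /=; rewrite lconjM.
Qed.

Lemma inversions_rcons u s :
  inversions (rcons u s) = rcons (inversions u) (lconj (wprod u) s).
Proof. by rewrite -cats1 inversions_cat cats1. Qed.

Lemma inversions_rev X u : involutions X -> word_in X u ->
  inversions (rev u) = map (lconj (wprod u)^-1) (rev (inversions u)).
Proof.
move=> invX; elim: u => [//|s u IH] /word_in_cons[Xs Xu].
rewrite rev_cons inversions_rcons IH // (wprod_rev invX Xu) wprod_cons /=.
rewrite rev_cons map_rcons -map_rev -map_comp invgM; congr rcons.
  by apply: eq_map => r /=; rewrite -lconjM mulgVK.
by rewrite lconjM; congr lconj; rewrite /lconj mulVg mul1g invgK.
Qed.

Lemma count_mem_lconj g r (L : seq W) :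
  count_mem r (map (lconj g) L) = count_mem (lconj g^-1 r) L.
Proof.
rewrite count_map; apply: eq_count => s /=.
by rewrite -{1}(lconjVK g r) (inj_eq (@lconj_inj g)).
Qed.

Lemma inversionsP u r : r \in inversions u ->
  exists p s q, u = p ++ s :: q /\ r = lconj (wprod p) s.
Proof.
elim: u r => [//|s u IH] r /=; rewrite inE => /predU1P[->|].
  by exists [::], s, u; rewrite wprod_nil lconj1.
move=> /mapP[t /IH[p [x [q [-> ->]]]] ->]; exists (s :: p), x, q; split=> //.
by rewrite wprod_cons lconjM.
Qed.

(** A repeated inversion [s_1 .. s_i .. s_1^-1 = s_1 .. s_j .. s_1^-1] cancels
   down to [s_i s_(i+1) .. s_(j-1) = s_(i+1) .. s_j]. *)
Lemma repeated_inversion u : ~~ uniq (inversions u) ->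
  exists p x q y z, u = p ++ x :: q ++ y :: z /\ x * wprod q = wprod q * y.
Proof.
elim: u => [//|s u IH] /=; rewrite negb_and negbK => /orP[/mapP[t tu st]|].
  have {st} ts : t = s.
    by apply: (@mulgI _ s); apply: (@mulIg _ s^-1); rewrite -[LHS]st mulgK.
  move: tu; rewrite {t}ts => /inversionsP[q [y [z [-> sE]]]].
  by exists [::], s, q, y, z; split=> //; rewrite {1}sE /lconj mulgVK.
rewrite map_inj_uniq; last exact: lconj_inj.
by move=> /IH[p [x [q [y [z [-> xq]]]]]]; exists (s :: p), x, q, y, z.
Qed.

Lemma delete_pair X p x q y z : involutions X -> X y ->
  x * wprod q = wprod q * y ->
  wprod (p ++ x :: q ++ y :: z) = wprod (p ++ q ++ z).
Proof.
move=> invX Xy xq; rewrite !wprod_cat !wprod_cons !wprod_cat wprod_cons.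
congr (_ * _); rewrite mulgA xq -mulgA; congr (_ * _).
by rewrite mulgA invX // mul1g.
Qed.

(** A repeated inversion would allow two letters to be deleted. *)
Lemma uniq_inversions X w u : involutions X -> reduced_word X w u ->
  uniq (inversions u).
Proof.
move=> invX [[Xu uw] umin]; apply/negPn/negP.
move=> /repeated_inversion[p [x [q [y [z [uE xq]]]]]].
have [] : [/\ word_in X p, word_in X q, word_in X z & X y].
  have : word_in X u by [].
  rewrite uE => /word_in_cat[Xp /word_in_cons[_ /word_in_cat[Xq]]].
  by move=> /word_in_cons[].
move=> Xp Xq Xz Xy; have : spells X w (p ++ q ++ z).
  split; first by apply/word_in_cat; split=> //; apply/word_in_cat.
  by have := delete_pair p z invX Xy xq; rewrite -uE /wprod uw => <-.
by move=> /umin; rewrite uE !size_cat /= size_cat /= !addnS !ltnNge leqW.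
Qed.

Section EvenInversions.
Variable X : set W.
Hypotheses (invX : involutions X) (evenX : even_inversions X).

(** The length is the sum of the multiplicities of the inversions. *)
Lemma even_size u : word_in X u -> wprod u = 1 -> ~~ odd (size u).
Proof.
move=> Xu u1; rewrite -size_inversions.
rewrite -(perm_size (perm_count_undup (inversions u))) size_flatten /shape.
elim: (undup _) => [|r L IH] //=; rewrite oddD size_nseq (negbTE IH) addbF.
exact: evenX.
Qed.

(** Evenness applied to [u ++ rev v]: up to order, its inversions are those of
   [u] together with those of [v]. *)
Lemma odd_count_inversions u v r : word_in X u -> word_in X v ->
  wprod u = wprod v ->
  odd (count_mem r (inversions u)) = odd (count_mem r (inversions v)).
Proof.
move=> Xu Xv uv; have Xw : word_in X (u ++ rev v).
  by apply/word_in_cat; split; last exact/word_in_rev.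
have w1 : wprod (u ++ rev v) = 1.
  by rewrite wprod_cat (wprod_rev invX Xv) uv mulgV.
have := evenX Xw w1 r; rewrite inversions_cat (inversions_rev invX Xv) uv.
rewrite -map_comp (eq_map (g := id)); last by move=> s /=; rewrite lconjVK.
by rewrite map_id count_cat count_rev oddD; case: odd; case: odd.
Qed.

Lemma perm_inversions u v : word_in X u -> word_in X v ->
  wprod u = wprod v -> uniq (inversions u) -> uniq (inversions v) ->
  perm_eq (inversions u) (inversions v).
Proof.
move=> Xu Xv uv uu uvv; apply: uniq_perm => // r.
have := odd_count_inversions r Xu Xv uv.
by rewrite !count_uniq_mem // !oddb.
Qed.

End EvenInversions.

(** The [i]-th inversion is a conjugate of the [i]-th letter. *)
Lemma count_inversions (P : pred W) X u :
  (forall s p, X s -> word_in X p -> P (lconj (wprod p) s) = P s) ->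
  word_in X u -> count P (inversions u) = count P u.
Proof.
move=> PX; elim/last_ind: u => [//|u s IH]; rewrite -cats1 => /word_in_cat[Xu].
move=> /word_in_cons[Xs _]; rewrite cats1 inversions_rcons -!cats1 !count_cat.
by rewrite IH //= PX.
Qed.

End Inversions.

(** * Every relation follows from the dihedral ones *)

Section Deletion.
Set Implicit Arguments.
Unset Strict Implicit.
Local Open Scope group_scope.

Lemma wprod_alternating (W : groupType) (x y : W) k :
  wprod (flatten (nseq k [:: x; y])) = (x * y) ^+ k.
Proof.
elim: k => [|k IH] /=; first exact: wprod_nil.
by rewrite !wprod_cons IH expgS mulgA.
Qed.

Lemma alternating_eq (T : eqType) (x0 : T) (u : seq T) k : size u = k.*2 ->
  (forall i, (i.+2 < size u)%N -> nth x0 u i = nth x0 u i.+2) ->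
  u = flatten (nseq k [:: nth x0 u 0; nth x0 u 1]).
Proof.
elim: k u => [|k IH] [|x [|y u]] //= [su] alt; congr [:: _, _ & _].
rewrite [LHS]IH //; last by move=> i iu; exact: (alt i.+2).
case: k su {IH} => // k; case: u alt => [|x' [|y' u]] //= alt _.
by have /= <- := alt 0%N isT; have /= <- := alt 1%N isT.
Qed.

Variables (W : groupType) (X : set W).
Hypotheses (invX : involutions X) (evenX : even_inversions X).
Variable E : seq W -> seq W -> Prop.
Hypotheses (Erefl : forall u, E u u) (Esym : forall u v, E u v -> E v u)
  (Etrans : forall u v w, E u v -> E v w -> E u w)
  (Ecat : forall p q u v, E u v -> E (p ++ u ++ q) (p ++ v ++ q))
  (Esquare : forall x, X x -> E [:: x; x] [::])
  (Edihedral : forall x y k, X x -> X y -> (x * y) ^+ k = 1 ->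
     E (flatten (nseq k [:: x; y])) [::]).

Lemma cancel_pair p x q : X x -> E (p ++ x :: x :: q) (p ++ q).
Proof. by move=> Xx; exact: (Ecat p q (Esquare Xx)). Qed.

Lemma cancel_rev u : word_in X u -> E (rev u ++ u) [::].
Proof.
elim: u => [|s u IH]; first by move=> _; exact: Erefl.
move=> /word_in_cons[Xs Xu]; rewrite rev_cons -cats1 -catA /=.
exact: Etrans (cancel_pair _ _ Xs) (IH Xu).
Qed.

Lemma equal_of_trivial u v : word_in X v -> E (u ++ rev v) [::] -> E u v.
Proof.
move=> Xv uv; apply: (@Etrans _ (u ++ (rev v ++ v) ++ [::])).
  by rewrite -{1}[u]cats0; exact: (@Ecat u [::] [::] _ (Esym (cancel_rev Xv))).
by rewrite cats0 catA; exact: (Ecat [::] v uv).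
Qed.

(** Rotating a word amounts to conjugating it by a generator. *)
Lemma trivial_rot1 u : word_in X u -> E (rot 1 u) [::] -> E u [::].
Proof.
case: u => [|x u]; first by move=> _ _; exact: Erefl.
move=> /word_in_cons[Xx _]; rewrite /rot /= drop0 take0 => ux.
apply: (@Etrans _ ((x :: u) ++ [:: x; x] ++ [::])).
  rewrite -{1}[x :: u]cats0.
  exact: (@Ecat (x :: u) [::] [::] _ (Esym (Esquare Xx))).
apply: Etrans (Esquare Xx).
by have := Ecat [:: x] [:: x] ux; rewrite /= -catA.
Qed.

Lemma word_in_rot u i : word_in X u -> word_in X (rot i u).
Proof. by move=> Xu s; rewrite mem_rot => /Xu. Qed.

Lemma trivial_rot u i : word_in X u -> E (rot i u) [::] -> E u [::].
Proof.
move=> Xu; elim: i => [|i IH]; first by rewrite rot0.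
have [iu|ui] := ltnP i (size u); last by rewrite rot_oversize // leqW.
rewrite -add1n rotD // => ui1; apply: IH; apply: trivial_rot1 ui1.
exact: word_in_rot.
Qed.

Lemma wprod_rot (u : seq W) i : wprod u = 1 -> wprod (rot i u) = 1.
Proof.
rewrite -{1}(cat_take_drop i u) !wprod_cat => ud.
by rewrite -(mulg1_eq ud) mulVg.
Qed.

(** The induction step, for words of length [n = 2 (k + 1)]. *)
Section Step.
Variables (n k : nat).
Hypothesis nk : n = k.+1.*2.
Hypothesis IH : forall u, (size u < n)%N -> word_in X u -> wprod u = 1 ->
  E u [::].

Lemma short_equal u v : word_in X u -> word_in X v -> wprod u = wprod v ->
  (size u + size v < n)%N -> E u v.
Proof.
move=> Xu Xv uv suv; apply: equal_of_trivial => //; apply: IH.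
- by rewrite size_cat size_rev.
- by apply/word_in_cat; split=> //; apply/word_in_rev.
- by rewrite wprod_cat (wprod_rev invX Xv) uv mulgV.
Qed.

(** The first [k + 2] letters of [u] have the same value as a word of length
   [k], so two of their inversions coincide and give a relation
   [x q = q y]. If it is shorter than [n], it holds for [E] and shortens [u] by
   two letters; otherwise it covers the [k + 2] letters, and it is the equality
   [s_1 .. s_(k+1) = s_2 .. s_(k+2)]. *)
Lemma trivial_or_shift u : word_in X u -> wprod u = 1 -> size u = n ->
  E u [::] \/ wprod (take k.+1 u) = wprod (take k.+1 (behead u)).
Proof.
move=> Xu u1 su; pose c := take k.+2 u; pose d := drop k.+2 u.
have uE : u = c ++ d by rewrite cat_take_drop.
have k2u : (k.+2 <= size u)%N by rewrite su nk doubleS !ltnS -addnn leq_addr.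
have sc : size c = k.+2 by rewrite size_takel.
have sd : size d = k.
  by rewrite size_drop su nk doubleS !subSS -addnn addnK.
have [Xc Xd] : word_in X c /\ word_in X d by apply/word_in_cat; rewrite -uE.
have cd : wprod c = wprod (rev d).
  rewrite (wprod_rev invX Xd); move: u1; rewrite uE wprod_cat => /mulg1_eq <-.
  by rewrite invgK.
have Xrd := (word_in_rev X d).2 Xd.
(* Distinct inversions of [c] would all be inversions of the shorter [rev d]. *)
have [uc|/repeated_inversion[p [x [q [y [z [cE xq]]]]]]] :=
  boolP (uniq (inversions c)).
  have : (size (inversions c) <= size (inversions (rev d)))%N.
    apply: uniq_leq_size => // r rc.
    have := odd_count_inversions invX evenX r Xc Xrd cd.
    rewrite count_uniq_mem // rc => /esym odd1.
    by rewrite -has_pred1 has_count; case: count odd1.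
  by rewrite !size_inversions size_rev sc sd ltnNge leqW.
have : word_in X c by [].
rewrite cE => /word_in_cat[Xp /word_in_cons[Xx /word_in_cat[Xq]]].
move=> /word_in_cons[Xy Xz].
have scE : (size p + size q + size z = k)%N.
  by move: sc; rewrite cE !size_cat /= size_cat /= !addnS addnA => -[].
have [qk|kq] := ltnP (size q) k; [left|right].
  have xqy : E (x :: q) (q ++ [:: y]).
    apply: short_equal.
    - exact/word_in_cons.
    - by apply/word_in_cat; split=> //; exact/word_in_cons.
    - by rewrite wprod_cons wprod_cat wprod_seq1.
    - by rewrite size_cat /= addn1 addnn nk ltn_double ltnS.
  apply: (@Etrans _ (p ++ q ++ y :: y :: z ++ d)).
    have := Ecat p (y :: z ++ d) xqy.
    by rewrite uE cE -!catA /= -catA.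
  apply: (@Etrans _ (p ++ q ++ z ++ d)).
    by have := cancel_pair (p ++ q) (z ++ d) Xy; rewrite -!catA.
  apply: IH.
  - by rewrite !size_cat sd addnA addnA scE nk addnn ltn_double.
  - by do !(apply/word_in_cat; split=> //).
  - rewrite -u1 uE cE -!catA /= -catA /=; apply/esym.
    exact: (delete_pair _ _ invX Xy xq).
have : (size p == 0) && (size z == 0)%N.
  by rewrite -addn_eq0 -leqn0 -(leq_add2r (size q)) addnAC scE.
move=> /andP[/nilP p0 /nilP z0]; move: scE; rewrite p0 z0 add0n addn0 => sq.
rewrite uE cE p0 z0 /= -catA /= take_size_cat //= -(cat1s y) catA take_size_cat.
  by rewrite wprod_cons wprod_cat wprod_seq1.
by rewrite size_cat sq addn1.
Qed.

(** Write the word as [s_1 .. s_(2k+2)]. Shifting it and its rotation gives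
   [s_1 .. s_(k+1) = s_2 .. s_(k+2)] and [s_2 .. s_(k+2) = s_3 .. s_(k+3)]. The
   second equality is a relation
   [s_3 (s_2 .. s_(k+2)) (s_4 .. s_(k+3))^-1 = 1] of the same length, and
   shifting this one gives [s_3 s_2 .. s_(k+1) = s_2 .. s_(k+2)]. Comparing with
   the first equality, [s_1 = s_3]. *)
Lemma trivial_or_alternating x y z u : word_in X [:: x, y, z & u] ->
  wprod [:: x, y, z & u] = 1 -> size [:: x, y, z & u] = n ->
  E [:: x, y, z & u] [::] \/ x = z.
Proof.
move=> Xw w1 sw; set w := [:: x, y, z & u] in Xw w1 sw *.
have k0 : (0 < k)%N by rewrite lt0n; apply/eqP => k0; move: sw; rewrite nk k0.
have [j kj] : exists j, k = j.+1 by by exists k.-1; rewrite prednK.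
have [Xx Xyzu] := (word_in_cons _ _ _).1 Xw.
have Xrw := word_in_rot (i := 1) Xw.
have := trivial_or_shift Xw w1 sw => -[|wE]; first by left.
have srw : size (rot 1 w) = n by rewrite size_rot.
have := trivial_or_shift Xrw (wprod_rot 1 w1) srw => -[/trivial_rot|rwE].
  by left; auto.
have su : size u = (j + j.+1)%N.
  by move: sw; rewrite /w nk kj /= doubleS => -[->]; rewrite addnS addnn.
pose M := take j u.
have sM : size M = j by rewrite size_takel // su leq_addr.
have [c [N uN]] : exists c N, rcons u x = M ++ c :: N.
  have : (j < size (rcons u x))%N by rewrite size_rcons su ltnS leq_addr.
  move=> /(drop_nth 1) dE; exists (nth 1 (rcons u x) j), (drop j.+1 (rcons u x)).
  rewrite -dE -cats1 -{1}(cat_take_drop j u) -catA; congr (_ ++ _).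
  by rewrite drop_cat su -[X in (X < _)%N]addn0 ltn_add2l.
have rwE' : rot 1 w = [:: y, z & M] ++ c :: N.
  by rewrite /w /rot /= ?drop0 ?take0 cats1 /= uN.
have sN : size N = j.+1.
  have := congr1 size uN; rewrite size_rcons size_cat /= sM su -addnS.
  by move=> /addnI [].
have [Xy /word_in_cons[Xz Xu]] := (word_in_cons _ _ _).1 Xyzu.
have [XM [Xc XN]] : word_in X M /\ X c /\ word_in X N.
  have : word_in X (rcons u x).
    by rewrite -cats1; apply/word_in_cat; split=> //; exact/word_in_cons.
  by rewrite uN => /word_in_cat[XM /word_in_cons[]].
(* [M] is [s_4 .. s_(k+2)] and [c] is [s_(k+3)]. *)
have yzMc : wprod [:: y, z & M] = wprod (z :: M ++ [:: c]).
  move: rwE; rewrite rwE' kj take_size_cat /= ?sM // => ->.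
  by rewrite -(cat1s c) catA take_size_cat // size_cat sM addn1.
have XzMc : word_in X (z :: M ++ [:: c]).
  apply/word_in_cons; split=> //; apply/word_in_cat; split=> //.
  exact/word_in_cons.
have XyzM : word_in X [:: y, z & M] by do !(apply/word_in_cons; split=> //).
pose b := [:: y, z & M] ++ rev (M ++ [:: c]).
have bz : b ++ [:: z] = [:: y, z & M] ++ rev (z :: M ++ [:: c]).
  by rewrite /b rev_cons -cats1 catA.
have Xbz : word_in X (b ++ [:: z]).
  by rewrite bz; apply/word_in_cat; split=> //; apply/word_in_rev.
have bz1 : wprod (b ++ [:: z]) = 1.
  by rewrite bz wprod_cat (wprod_rev invX XzMc) yzMc mulgV.
have zb : rot (size b) (b ++ [:: z]) = z :: b by rewrite rot_size_cat.
have := @trivial_or_shift (z :: b); rewrite -zb => /(_ _ _ _)[||||].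
- exact: word_in_rot.
- exact: wprod_rot.
- rewrite size_rot size_cat /b size_cat size_rev size_cat sM nk kj /= sM.
  by rewrite !addn1 !addnS addSn -addnn !addSn !addnS.
(* If the new relation is trivial, the second equality holds for [E] and brings
   the two letters [c] of the rotated word together. *)
- move=> /(trivial_rot Xbz); rewrite bz => /(equal_of_trivial XzMc) yzE.
  left; apply: (@trivial_rot _ 1) => //; rewrite rwE'.
  have E1 := Ecat [::] (c :: N) yzE.
  have E2 := cancel_pair (z :: M) N Xc.
  apply: Etrans E1 _; rewrite /= -catA; apply: Etrans E2 _; apply: IH.
  + by rewrite size_cat /= sM sN nk kj -addnn !addSn !addnS ltnS leqnSn.
  + by apply/word_in_cat; split=> //; apply/word_in_cons.
  rewrite -(wprod_rot 1 w1) rwE' [RHS]wprod_cat yzMc -cat_cons.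
  rewrite !wprod_cat wprod_seq1 !wprod_cons -!mulgA.
  by rewrite (mulgA c c) invX // mul1g.
rewrite zb => bE; right.
have tz : take j (z :: u) = take j (z :: M).
  by rewrite -{1}(cat_take_drop j u) -cat_cons takel_cat //= sM.
move: wE bE; rewrite /w /b kj /= tz -/M => wE.
rewrite -cat_cons takel_cat ?take_size_cat /= ?sM // => bE.
move: (etrans wE (esym bE)); rewrite !wprod_cons !mulgA.
by move=> /mulIg /mulIg.
Qed.

End Step.

(** Unless it is already trivial for [E], a word of value 1 alternates between two
   letters, by [trivial_or_alternating] applied to all its rotations. *)
Lemma relation_trivial u : word_in X u -> wprod u = 1 -> E u [::].
Proof.
have [n] := ubnP (size u); elim: n u => // n IHn u su Xu u1.
have [u0|u0] := posnP (size u); first by rewrite (size0nil u0); exact: Erefl.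
have [k sk] : exists k, size u = k.+1.*2.
  have := odd_double_half (size u); rewrite (negbTE (even_size evenX Xu u1)).
  by case: (_./2) => [s0|k <-]; [rewrite -s0 in u0|exists k].
have IH v : (size v < size u)%N -> word_in X v -> wprod v = 1 -> E v [::].
  by move=> vu; apply: IHn; apply: leq_trans vu _.
have [//|nE] := pselect (E u [::]).
have alt i : (i.+2 < size u)%N -> nth 1 u i = nth 1 u i.+2.
  move=> iu; have i1u := ltnW iu; have i0u := ltnW i1u.
  have := @trivial_or_alternating _ _ sk IH (nth 1 u i) (nth 1 u i.+1)
    (nth 1 u i.+2) (drop i.+3 u ++ take i u).
  rewrite -!cat_cons -!drop_nth // -/(rot i u) => /(_ _ _ _)[||||//].
  - exact: word_in_rot.
  - exact: wprod_rot.
  - by rewrite size_rot.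
  - by move=> /(trivial_rot Xu).
rewrite (alternating_eq sk alt); apply: Edihedral.
- by apply/Xu/mem_nth.
- by apply/Xu/mem_nth; rewrite sk doubleS.
- by rewrite -wprod_alternating -(alternating_eq sk alt).
Qed.

Lemma equal_words u v : word_in X u -> word_in X v -> wprod u = wprod v ->
  E u v.
Proof.
move=> Xu Xv uv; apply: equal_of_trivial => //; apply: relation_trivial.
  by apply/word_in_cat; split=> //; exact/word_in_rev.
by rewrite wprod_cat (wprod_rev invX Xv) uv mulgV.
Qed.

End Deletion.

(** * Coxeter systems and even inversions *)

Section Presentations.
Set Implicit Arguments.
Unset Strict Implicit.
Local Open Scope group_scope.

Lemma pres_eq_cat (T : Type) (R : set (seq (T * bool))) p q u v :
  pres_eq R u v -> pres_eq R (p ++ u ++ q) (p ++ v ++ q).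
Proof.
elim=> {u v} [u|u v _|u v w _ uv _ vw|u v x b|u v r Rr].
- exact: pres_refl.
- exact: pres_sym.
- exact: pres_trans uv vw.
- by have := pres_cancel R (p ++ u) (v ++ q) x b; rewrite -!catA.
- by have := pres_relator (p ++ u) (v ++ q) Rr; rewrite -!catA.
Qed.

Variables (W : groupType) (S : set W).

Definition eval_word (G : groupType) (g : W -> G) (u : seq (S * bool)) : G :=
  \prod_(a <- u) (if a.2 then (g (set_val a.1))^-1 else g (set_val a.1)).

Lemma eval_word_cat (G : groupType) (g : W -> G) u v :
  eval_word g (u ++ v) = eval_word g u * eval_word g v.
Proof. exact: big_cat. Qed.

Lemma eval_word_relator (G : groupType) (g : W -> G) (s t : S) k :
  eval_word g (flatten (nseq k [:: (s, false); (t, false)])) =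
  (g (set_val s) * g (set_val t)) ^+ k.
Proof.
elim: k => [|k IH] /=; first by rewrite /eval_word big_nil.
by rewrite /eval_word !big_cons /= [X in _ * (_ * X)]IH expgS mulgA.
Qed.

Lemma pres_eq_eval (R : set (seq (S * bool))) (G : groupType) (g : W -> G) u v :
  (forall r, R r -> eval_word g r = 1) -> pres_eq R u v ->
  eval_word g u = eval_word g v.
Proof.
move=> R1; elim=> {u v} [//|//|u v w _ -> _ ->//|u v x b|u v r Rr].
  rewrite !eval_word_cat; congr (_ * _); rewrite -[RHS]mul1g; congr (_ * _).
  by rewrite /eval_word big_cons big_seq1; case: b => /=; rewrite ?mulVg ?mulgV.
by rewrite !eval_word_cat (R1 r) // mul1g.
Qed.

Definition letters (u : seq (S * bool)) : seq W := [seq set_val a.1 | a <- u].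

Lemma letters_in u : word_in S (letters u).
Proof. by move=> _ /mapP[[s b] _ ->]; exact: set_valP. Qed.

Lemma word_valueE u : involutions S -> word_value u = wprod (letters u).
Proof.
move=> invS; rewrite /word_value /wprod big_map; apply: eq_bigr => -[s []] //= _.
by rewrite (mulg1_eq (invS _ (set_valP s))).
Qed.

(** Dropping the letters outside [S] makes this a total function that commutes
   with concatenation. *)
Definition positive_word (u : seq W) : seq (S * bool) :=
  [seq (s, false) | s <- pmap insub u].

Lemma positive_word_cat u v :
  positive_word (u ++ v) = positive_word u ++ positive_word v.
Proof. by rewrite /positive_word pmap_cat map_cat. Qed.

Lemma positive_word_cons s u (Ss : S s) :
  positive_word (s :: u) = (SigSub (mem_set Ss), false) :: positive_word u.
Proof.
rewrite /positive_word /=; case: insubP => [x _ xs|/negP[]]; last exact/mem_set.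
by congr ((_, _) :: _); exact: val_inj.
Qed.

Lemma letters_positive u : word_in S u -> letters (positive_word u) = u.
Proof.
elim: u => // s u IH /word_in_cons[Ss /IH {}IH].
by rewrite (positive_word_cons _ Ss) /= IH.
Qed.

Lemma positive_letters (s : S) b u :
  positive_word (letters ((s, b) :: u)) = (s, false) :: positive_word (letters u).
Proof.
rewrite /= (positive_word_cons _ (set_valP s)); congr ((_, _) :: _).
exact: val_inj.
Qed.

Lemma range_word_value : involutions S ->
  range (@word_value W S) = products S.
Proof.
move=> invS; apply/seteqP; split=> [_ [u _ <-]|_ [u Su <-]].
  by exists (letters u); [exact: letters_in|rewrite -word_valueE].
by exists (positive_word u); rewrite // word_valueE // letters_positive.
Qed.

Lemma coxeter_word_value H m (r : seq (S * bool)) : coxeter_system H S m ->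
  coxeter_relators (S := S) m r -> word_value r = 1.
Proof.
move=> [_ [_ presS]] Rr; rewrite (presS r [::]).2 ?/word_value ?big_nil //.
by have := pres_relator [::] [::] Rr; rewrite cats0.
Qed.

Lemma coxeter_relation H m s t k : coxeter_system H S m -> S s -> S t ->
  m s t = Some k -> (s * t) ^+ k = 1.
Proof.
move=> cox Ss St mst.
have := @coxeter_word_value _ _ (flatten (nseq k
  [:: (SigSub (mem_set Ss), false); (SigSub (mem_set St), false)])) cox.
rewrite -[word_value _]/(eval_word id _) eval_word_relator; apply.
by exists (SigSub (mem_set Ss)), (SigSub (mem_set St)), k.
Qed.

Lemma coxeter_involutions H m : coxeter_system H S m -> involutions S.
Proof.
move=> cox s Ss; have [mss _ _] := cox.1 s s Ss Ss.
exact: (coxeter_relation cox Ss Ss mss).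
Qed.

(** The universal property of the presentation: [f w] is computed on an arbitrary
   word for [w]. *)
Lemma coxeter_hom m (G : groupType) (g : W -> G) :
  coxeter_system [set: W] S m ->
  (forall s t k, S s -> S t -> m s t = Some k -> (g s * g t) ^+ k = 1) ->
  exists2 f : W -> G, {morph f : x y / x * y} & forall s, S s -> f s = g s.
Proof.
move=> [_ [genS presS]] grel.
have /choice[c cP] w : exists u : seq (S * bool), word_value u = w.
  have [u _ <-] : range (@word_value W S) w by rewrite genS.
  by exists u.
have fE u : eval_word g (c (word_value u)) = eval_word g u.
  apply: (@pres_eq_eval (coxeter_relators (S := S) m)); last exact/presS/cP.
  move=> _ [s [t [k [mst ->]]]]; rewrite eval_word_relator.
  by apply: grel mst; exact: set_valP.
exists (fun w => eval_word g (c w)) => [x y|s Ss].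
  by rewrite -eval_word_cat -[RHS]fE /word_value big_cat /= -!/(word_value _) !cP.
have sE : s = word_value [:: (SigSub (mem_set Ss) : S, false)].
  by rewrite /word_value big_seq1.
by rewrite {1}sE fE /eval_word big_seq1.
Qed.

Definition same_inversions (u v : seq W) : Prop :=
  wprod u = wprod v /\
  forall r, odd (count_mem r (inversions u)) = odd (count_mem r (inversions v)).

Lemma same_inversions_drop u r v : same_inversions r [::] ->
  same_inversions (u ++ r ++ v) (u ++ v).
Proof.
move=> [r1 rodd]; rewrite wprod_nil in r1.
split=> [|s]; first by rewrite !wprod_cat r1 mul1g.
rewrite !inversions_cat r1 (eq_map (@lconj1 W)) map_id map_cat !count_cat !oddD.
by rewrite (count_mem_lconj _ _ (inversions r)) rodd addFb.
Qed.

(** In the alternating word [s t s t ..] of length [2k], the [i]-th inversion is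
   [(s t)^i s]; when [(s t)^k = 1], it is equal to the [(i + k)]-th one. *)
Lemma alternating_inversions (s t : W) k : involutions S -> S s -> S t ->
  (s * t) ^+ k = 1 -> same_inversions (flatten (nseq k [:: s; t])) [::].
Proof.
move=> invS Ss St stk; split=> [|r]; first by rewrite wprod_alternating wprod_nil.
have ss := invS s Ss; have tt := invS t St.
have invE n : inversions (flatten (nseq n [:: s; t])) =
    [seq (s * t) ^+ i * s | i <- iota 0 n.*2].
  elim: n => [//|n IH]; rewrite doubleS /= IH expg0 mul1g expg1.
  rewrite -!map_comp (iotaDl 2 0) -map_comp /lconj (mulg1_eq ss).
  congr [:: _, _ & _]; apply: eq_map => i /=.
  by rewrite (mulg1_eq tt) expgS expgSr !mulgA.
have half : [seq (s * t) ^+ i * s | i <- iota k k] =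
    [seq (s * t) ^+ i * s | i <- iota 0 k].
  rewrite -{1}[k]addn0 iotaDl -map_comp; apply: eq_map => i /=.
  by rewrite expgnDr stk mul1g.
by rewrite invE -addnn iotaD map_cat count_cat add0n half addnn odd_double.
Qed.

(** Inserting a relator leaves the other inversions unchanged, as the relator has
   value 1, and adds an even number to each multiplicity. *)
Lemma coxeter_even_inversions H m : coxeter_system H S m -> even_inversions S.
Proof.
move=> cox; have invS := coxeter_involutions cox.
have presE u v : pres_eq (coxeter_relators (S := S) m) u v ->
    same_inversions (letters u) (letters v).
  elim=> {u v} [u|u v _ [uv ouv]|u v w _ [uv ouv] _ [vw ovw]|u v x b|u v r].
  - by [].
  - by split=> [|r]; rewrite ?uv ?ouv.
  - by split=> [|r]; rewrite ?uv ?ouv ?vw ?ovw.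
  - rewrite /letters !map_cat; apply: same_inversions_drop.
    have xx := invS _ (set_valP x).
    by have := alternating_inversions (k := 1) invS (set_valP x) (set_valP x) xx.
  - move=> [s [t [k [mst ->]]]]; rewrite /letters !map_cat.
    rewrite map_flatten map_nseq; apply: same_inversions_drop.
    apply: alternating_inversions => //; try exact: set_valP.
    by apply: (coxeter_relation cox _ _ mst); exact: set_valP.
move=> u Su u1 r; have [_ presS] := cox.2.
have := presS (positive_word u) [::].
rewrite !(word_valueE _ invS) letters_positive // [wprod (letters [::])]wprod_nil.
by move=> /iffLR /(_ u1) /presE[_ /(_ r)]; rewrite letters_positive // => ->.
Qed.

(** Infinite order is treated as order 0, since 0 divides only 0. *)
Lemma order_exists (g : W) : exists o : option nat,
  o <> Some 0%N /\ forall n, g ^+ n = 1 <-> (odflt 0 o %| n)%N.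
Proof.
have [gk|gk] := pselect (exists k, (0 < k)%N && (g ^+ k == 1)); last first.
  exists None; split=> // n; rewrite dvd0n; split=> [gn|/eqP-> //].
  by apply/negPn/negP; rewrite -lt0n => n0; apply: gk; exists n; rewrite n0 gn eqxx.
case: (ex_minnP gk) => k /andP[k0 /eqP gk1] kmin; exists (Some k); split=> [[kE]|n].
  by rewrite kE in k0.
split=> [gn1|/dvdnP[q ->]]; last by rewrite mulnC expgnA gk1 expg1n.
rewrite /= /dvdn -leqn0 leqNgt; apply/negP => nk.
have := kmin (n %% k)%N; rewrite nk /= leqNgt ltn_mod k0; apply/implyP.
move: gn1; rewrite {1}(divn_eq n k) expgnDr mulnC expgnA gk1 expg1n mul1g.
by move=> ->; rewrite eqxx.
Qed.

Lemma order_unique (g h : W) o o' :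
  o <> Some 0%N -> o' <> Some 0%N ->
  (forall n, g ^+ n = 1 <-> (odflt 0 o %| n)%N) ->
  (forall n, h ^+ n = 1 <-> (odflt 0 o' %| n)%N) ->
  (forall n, g ^+ n = 1 <-> h ^+ n = 1) -> o = o'.
Proof.
move=> o0 o0' og oh gh; have : odflt 0%N o = odflt 0%N o'.
  by apply/eqP; rewrite eqn_dvd; apply/andP; split;
    [apply/og/gh/oh|apply/oh/gh/og].
by case: o o' o0 o0' {og oh} => [[|k]|] [[|k']|] //= _ _ [->].
Qed.

(** The exponents are the orders of the products [s t]. The relation [E] used to
   compare words of generators is equality in the presented group. *)
Lemma coxeter_system_of_even_inversions H : involutions S -> even_inversions S ->
  range (@word_value W S) = H -> exists m, coxeter_system H S m.
Proof.
move=> invS evenS genS; have /choice[o oP] := order_exists.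
have relk s t k : o (s * t) = Some k -> (s * t) ^+ k = 1.
  by move=> ok; apply/(oP _).2; rewrite ok.
exists (fun s t => o (s * t)); split; [|split=> // u v; split].
- move=> s t Ss St; have [o0 oE] := oP (s * t); split.
  + rewrite (invS s Ss); apply: (@order_unique 1 1) => //; try exact: (oP 1).2.
    * exact: (oP 1).1.
    * by move=> n; rewrite dvd1n expg1n.
  + apply: (order_unique o0 (oP (t * s)).1 oE (oP (t * s)).2) => n.
    have -> : t * s = (s * t)^-1.
      by rewrite invgM (mulg1_eq (invS s Ss)) (mulg1_eq (invS t St)).
    rewrite expVgn; split=> [->|stn]; first exact: invg1.
    by rewrite -[LHS]invgK stn invg1.
  + case: (o _) (relk s t) o0 => // -[|[|k]] // /(_ _ erefl); rewrite expg1 => st1 _ [].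
    by rewrite -[LHS]mulg1 -(invS t) // mulgA st1 mul1g.
- pose R := coxeter_relators (S := S) (fun s t => o (s * t)).
  have oxx (x : S) : R [:: (x, false); (x, false)].
    exists x, x, 1%N; split=> //; rewrite (invS _ (set_valP x)).
    apply: (order_unique (oP 1).1 _ (oP 1).2 _ (fun n => iff_refl _)) => // n.
    by rewrite dvd1n expg1n.
  have posE w : pres_eq R w (positive_word (letters w)).
    elim: w => [|[x b] w IH]; first exact: pres_refl.
    apply: (pres_trans (v := (x, false) :: w)); last first.
      rewrite positive_letters.
      by have := pres_eq_cat [:: (x, false)] [::] IH; rewrite /= !cats0.
    (* The relator [x x] turns the formal inverse of [x] into [x]. *)
    case: b; last exact: pres_refl.
    have := pres_relator [:: (x, true)] w (oxx x).
    have := pres_cancel R [::] ((x, false) :: w) x true.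
    by move=> /= xw /pres_sym xxw; exact: pres_trans xxw xw.
  pose E p q := pres_eq R (positive_word p) (positive_word q).
  rewrite !(word_valueE _ invS) => uv.
  apply: pres_trans (posE u) _; apply: pres_trans _ (pres_sym (posE v)).
  have Erefl p : E p p by exact: pres_refl.
  have Esym p q : E p q -> E q p by exact: pres_sym.
  have Etrans p q w : E p q -> E q w -> E p w by exact: pres_trans.
  have Ecat p q y z : E y z -> E (p ++ y ++ q) (p ++ z ++ q).
    by move=> yz; rewrite /E !positive_word_cat; exact: pres_eq_cat.
  have Esquare x : S x -> E [:: x; x] [::].
    move=> Sx; rewrite /E !(positive_word_cons _ Sx).
    exact: (pres_relator [::] [::] (oxx _)).
  have Edihedral x y k : S x -> S y -> (x * y) ^+ k = 1 ->
      E (flatten (nseq k [:: x; y])) [::].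
    move=> Sx Sy /(oP (x * y)).2 /dvdnP[q ->].
    case oxy : (o (x * y)) => [d|]; last by rewrite muln0.
    elim: q => [//|q IH]; rewrite mulSn nseqD flatten_cat.
    apply: (Etrans _ _ _ _ IH); apply: (Ecat [::] _ _ [::]).
    have -> : flatten (nseq d [:: x; y]) = letters (flatten (nseq d
        [:: (SigSub (mem_set Sx) : S, false); (SigSub (mem_set Sy) : S, false)])).
      by rewrite /letters map_flatten map_nseq.
    apply: pres_trans (pres_sym (posE _)) _.
    rewrite -[X in pres_eq _ X _]cats0; apply: (pres_relator [::] [::]).
    by exists (SigSub (mem_set Sx)), (SigSub (mem_set Sy)), d.
  apply: (equal_words invS evenS Erefl Esym Etrans Ecat Esquare Edihedral _ _ uv);
    exact: letters_in.
- apply: (pres_eq_eval (g := id)) => _ [s [t [k [mst ->]]]].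
  by rewrite eval_word_relator; exact: relk.
Qed.

End Presentations.

(** * Subgroups generated by involutions *)

Section Subgroups.
Set Implicit Arguments.
Unset Strict Implicit.
Local Open Scope group_scope.
Variable W : groupType.
Implicit Types (A H : set W) (u v : seq W).

Lemma is_subgroupP H : is_subgroup H <->
  H 1 /\ forall x y, H x -> H y -> H (x * y^-1).
Proof.
split=> [[/set_mem H1 HV]|[H1 HV]].
  by split=> // x y /mem_set Hx /mem_set Hy; exact/set_mem/HV.
by split=> [|x y /set_mem Hx /set_mem Hy]; apply/mem_set => //; exact: HV.
Qed.

Lemma subgroupV H x : is_subgroup H -> H x -> H x^-1.
Proof. by move=> /is_subgroupP[H1 HV] Hx; rewrite -[_^-1]mul1g; exact: HV _ _ H1 Hx. Qed.

Lemma subgroupM H x y : is_subgroup H -> H x -> H y -> H (x * y).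
Proof.
move=> sH Hx Hy; rewrite -[y]invgK; apply: ((is_subgroupP H).1 sH).2 => //.
exact: subgroupV.
Qed.

Lemma subgroup_wprod H A u : is_subgroup H -> A `<=` H -> word_in A u ->
  H (wprod u).
Proof.
move=> sH AH; elim: u => [|s u IH].
  by move=> _; rewrite wprod_nil; exact: ((is_subgroupP H).1 sH).1.
by move=> /word_in_cons[/AH Hs /IH Hu]; rewrite wprod_cons; exact: subgroupM.
Qed.

Lemma products_sub A : A `<=` products A.
Proof.
move=> s As; exists [:: s]; last exact: wprod_seq1.
by apply/word_in_cons; split.
Qed.

Lemma products_subgroup A : involutions A -> is_subgroup (products A).
Proof.
move=> invA; apply/is_subgroupP; split=> [|_ _ [u Au <-] [v Av <-]].
  by exists [::]; rewrite ?wprod_nil.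
exists (u ++ rev v); first by apply/word_in_cat; split=> //; apply/word_in_rev.
by rewrite wprod_cat (wprod_rev invA Av).
Qed.

Lemma subgroup_genE A : involutions A -> subgroup_gen A = products A.
Proof.
move=> invA; apply/seteqP; split.
  by apply: smallest_sub; [exact: products_subgroup|exact: products_sub].
by move=> _ [u Au <-] M [sM AM]; exact: subgroup_wprod sM AM Au.
Qed.

Lemma reduced_word_exists A w : products A w -> exists u, reduced_word A w u.
Proof.
move=> [u Au uw]; have ex : exists n, `[< exists v, spells A w v /\ size v = n >].
  by exists (size u); apply/asboolP; exists u.
case: (ex_minnP ex) => n /asboolP[v [Av vn]] nmin; exists v; split=> // z Az.
by rewrite vn; apply: nmin; apply/asboolP; exists z.
Qed.

End Subgroups.

(** * Monomials of group elements *)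

Section Monomials.
Set Implicit Arguments.
Unset Strict Implicit.

Lemma expcmnE (I : choiceType) (J : {cmonom I}) n (x : I) :
  expcmn J n x = (n * J x)%N.
Proof.
rewrite /expcmn; case: n => [|n]; first by rewrite /= onecmE.
rewrite iteropS; elim: n => [|n IH]; first by rewrite mul1n.
by rewrite /= mulcmE IH mulSn.
Qed.

Lemma big_cmonomE (I : choiceType) (T : Type) (r : seq T) (F : T -> {cmonom I})
    (x : I) :
  (\big[mmul/mone]_(i <- r) F i : {cmonom I}) x = (\sum_(i <- r) F i x)%N.
Proof. by elim/big_rec2: _ => [|i n J _ <-]; [exact: cm1|exact: cmM]. Qed.

Definition word_monomial (W : groupType) (I : choiceType) (phi : W -> I)
  (u : seq W) : {cmonom I} := \big[mmul/mone]_(s <- u) ucm (phi s).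

Lemma word_monomialE (W : groupType) (I : choiceType) (phi : W -> I) u x :
  word_monomial phi u x = count (fun s => phi s == x) u.
Proof.
rewrite /word_monomial big_cmonomE -sum1_count [RHS]big_mkcond.
by apply: eq_bigr => s _; rewrite ucmE; case: eqP.
Qed.

Lemma mdeg_word_monomial (W : groupType) (I : choiceType) (phi : W -> I) u :
  mdeg (word_monomial phi u) = size u.
Proof.
rewrite /word_monomial mdeg_prod -sum1_size.
by apply: eq_bigr => s _; rewrite mdegU.
Qed.

Section MonomialOf.
Variables (W : groupType) (H X : set W) (I : choiceType) (phi : W -> I).
Hypotheses (invX : involutions X) (evenX : even_inversions X).
Hypotheses (sH : is_subgroup H) (XH : X `<=` H) (phiP : allowable H X phi).
Local Open Scope group_scope.

(** The word [u] and the chosen reduced word have the same inversions, and the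
   number of letters [s] with [phi s = x] is the number of inversions conjugate
   to such letters. *)
Lemma partial_lengthE u x : word_in X u -> uniq (inversions u) ->
  partial_length X (X `&` phi @^-1` [set x]) (wprod u) =
  count (fun s => phi s == x) u.
Proof.
move=> Xu uu; rewrite /partial_length.
have [|v vred] := @reduced_word_exists W X (wprod u); first by exists u.
move: (xgetPex [::] (ex_intro _ v vred)); set v' := xget _ _.
move: v' => {vred}v vred; have [[Xv vw] _] := vred.
have uv := uniq_inversions invX vred.
pose P r := `[< exists s g, [/\ X s, phi s = x, H g & r = lconj g s] >].
have Pphi s : X s -> P s = (phi s == x).
  move=> Xs; apply/asboolP/eqP => [[t [g [Xt <- Hg sE]]]|sx].
    apply/esym/phiP => //; exists g^-1; first exact: subgroupV.
    by rewrite sE conjg_lconj invgK.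
  by exists s, 1; split; rewrite ?lconj1 //; exact: ((is_subgroupP H).1 sH).1.
have PX s p : X s -> word_in X p -> P (lconj (wprod p) s) = P s.
  move=> Xs Xp; have Hp := subgroup_wprod sH XH Xp.
  apply/asboolP/asboolP => -[t [g [Xt tx Hg sE]]]; exists t.
    exists ((wprod p)^-1 * g); split=> //.
      by apply: subgroupM => //; exact: subgroupV.
    by rewrite lconjM -sE lconjK.
  exists (wprod p * g); split=> //; first exact: subgroupM.
  by rewrite lconjM -sE.
have phiE z : word_in X z ->
    count (fun s => phi s == x) z = count P (inversions z).
  move=> Xz; rewrite (count_inversions PX Xz); apply: eq_in_count => s /Xz Xs.
  by rewrite Pphi.
rewrite (phiE u Xu) -(permP (perm_inversions invX evenX Xv Xu vw uv uu)) -phiE //.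
apply: eq_in_count => s /Xv Xs; apply/idP/eqP => [/set_mem[]//|sx].
exact/mem_set.
Qed.

Lemma monomial_ofE u : word_in X u -> uniq (inversions u) ->
  monomial_of X phi (wprod u) = word_monomial phi u.
Proof.
move=> Xu uu; apply/eqP/cmP => x; rewrite word_monomialE /monomial_of.
pose A : {fset I} := seq_fset tt (map phi u).
have count0 y : y \notin A -> count (fun s => phi s == y) u = 0%N.
  move=> yA; apply/eqP; rewrite -leqn0 leqNgt -has_count.
  by apply: contra yA => /hasP[s su /eqP <-]; rewrite seq_fsetE map_f.
rewrite (fsbigTE A) => [|y yA]; last first.
  by apply/eqP/cmP => z; rewrite partial_lengthE // expcmnE cm1 count0.
rewrite big_cmonomE.
under eq_bigr => y _ do rewrite expcmnE ucmE partial_lengthE //.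
have [xA|xA] := boolP (x \in A).
  rewrite (bigD1_seq x) ?fset_uniq //= eqxx muln1 big1 ?addn0 // => y.
  by move=> /negbTE ->; rewrite muln0.
rewrite count0 // big_seq big1 // => y yA.
by case: eqP => [yx|_]; [rewrite -yx yA in xA|rewrite muln0].
Qed.

End MonomialOf.

Lemma finite_words (T : eqType) (X : set T) n : finite_set X ->
  finite_set [set u : seq T | (forall s, s \in u -> X s) /\ size u = n].
Proof.
move=> finX; elim: n => [|n IH].
  by apply: (sub_finite_set _ (finite_set1 [::])) => u [_ /size0nil].
apply: (sub_finite_set _ (finite_image2 cons finX IH)) => -[|s u] [Xu] //= [su].
exists s; first by apply: Xu; rewrite inE eqxx.
by exists u => //; split=> // t tu; apply: Xu; rewrite inE tu orbT.
Qed.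

(** The degree of the monomial of [w] is the length of [w]. *)
Lemma finite_monomial_fiber (W : groupType) (H X : set W) (I : choiceType)
    (phi : W -> I) (J : {cmonom I}) :
  involutions X -> even_inversions X -> is_subgroup H -> products X = H ->
  allowable H X phi -> finite_set X ->
  finite_set [set w | H w /\ monomial_of X phi w = J].
Proof.
move=> invX evenX sH XH phiP finX.
apply: (sub_finite_set _ (finite_image (@wprod W) (finite_words (mdeg J) finX))).
move=> w [Hw wJ]; have [u ured] : exists u, reduced_word X w u.
  by apply: reduced_word_exists; rewrite XH.
have uu := uniq_inversions invX ured; case: ured => -[Xu uw] _; exists u => //.
split=> //; rewrite -wJ -uw -/(wprod u) (monomial_ofE invX evenX sH _ phiP) //.
  by rewrite mdeg_word_monomial.
by rewrite -XH; exact: products_sub.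
Qed.

End Monomials.

(** * The retraction onto the subgroup generated by [S \ T] *)

Section Retraction.
Set Implicit Arguments.
Unset Strict Implicit.
Local Open Scope group_scope.

Variables (W : groupType) (S T : set W) (m : W -> W -> option nat).
Hypotheses (cox : coxeter_system [set: W] S m) (TS : T `<=` S).
Hypothesis even_m : forall t s, T t -> (S `\` T) s -> even_or_infinite (m s t).

Let invS : involutions S := coxeter_involutions cox.
Let evenS : even_inversions S := coxeter_even_inversions cox.
Let U := subgroup_gen (S `\` T).
Let ST := conj_generators S T.
Let UE : U = products (S `\` T).
Proof. by apply: subgroup_genE => s [Ss _]; exact: invS. Qed.
Let sU : is_subgroup U.
Proof. by rewrite UE; apply: products_subgroup => s [Ss _]; exact: invS. Qed.

(** A relator [(s t)^k] with exactly one letter in [T] is sent to the [k]-th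
   power of an involution, and [k] is even. *)
Lemma retraction_exists : exists f : W -> W, [/\ {morph f : x y / x * y},
  forall t, T t -> f t = 1 & forall s, (S `\` T) s -> f s = s].
Proof.
pose g s := if s \in T then 1 else s.
have [s t k Ss St mst|f fM fg] := coxeter_hom (g := g) cox.
  have [_ mC _] := cox.1 s t Ss St.
  have sqr_even (x : W) : x * x = 1 -> ~~ odd k -> x ^+ k = 1.
    move=> xx kE; rewrite -(even_halfK kE) -muln2 mulnC expgnA.
    by rewrite expg2 xx expg1n.
  rewrite /g; have [sT|/negP sT] := boolP (s \in T);
      have [tT|/negP tT] := boolP (t \in T).
  - by rewrite mul1g expg1n.
  - rewrite mul1g; apply: sqr_even; first exact: invS.
    have := even_m (set_mem sT) (conj St (fun Tt => tT (mem_set Tt))).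
    by rewrite -mC mst.
  - rewrite mulg1; apply: sqr_even; first exact: invS.
    have := even_m (set_mem tT) (conj Ss (fun Ts => sT (mem_set Ts))).
    by rewrite mst.
  - exact: (coxeter_relation cox Ss St mst).
exists f; split=> // [t Tt|s [Ss Ts]].
  by rewrite (fg _ (TS Tt)) /g mem_set.
by rewrite (fg _ Ss) /g memNset.
Qed.

Variable f : W -> W.
Hypotheses (fM : {morph f : x y / x * y}) (fT : forall t, T t -> f t = 1)
  (fST : forall s, (S `\` T) s -> f s = s).

Lemma retr1 : f 1 = 1.
Proof. by apply: (@mulgI _ (f 1)); rewrite -fM !mulg1. Qed.

Lemma retrV x : f x^-1 = (f x)^-1.
Proof. by apply/esym/mulg1_eq; rewrite -fM mulgV retr1. Qed.

Lemma retrU u : U u -> f u = u.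
Proof.
rewrite UE => -[c Sc <-]; elim: c Sc => [|s c IH].
  by rewrite wprod_nil retr1.
by move=> /word_in_cons[Ss /IH {}IH]; rewrite wprod_cons fM IH fST.
Qed.

Lemma retr_lconj g r : f (lconj g r) = lconj (f g) (f r).
Proof. by rewrite /lconj !fM retrV. Qed.

(** The word [s] has a single inversion. *)
Lemma generator_neq1 s : S s -> s <> 1.
Proof.
move=> Ss s1; have Xs : word_in S [:: s] by apply/word_in_cons.
by have := evenS Xs (etrans (wprod_seq1 s) s1) s; rewrite /= eqxx.
Qed.

(** Among the conjugates of the generators, the conjugates of [T] are those
   killed by the retraction. *)
Definition T_reflection (r : W) : bool := f r == 1.

Lemma T_reflectionP s : S s -> T_reflection s <-> T s.
Proof.
move=> Ss; split=> [/eqP fs|/fT/eqP//]; apply: contrapT => Ts.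
by apply: (generator_neq1 Ss); rewrite -fs fST.
Qed.

Lemma T_reflection_lconj g r : T_reflection (lconj g r) = T_reflection r.
Proof. by rewrite /T_reflection retr_lconj lconj_eq1. Qed.

Lemma filter_T_lconj g L :
  seq.filter T_reflection (map (lconj g) L) = map (lconj g) (seq.filter T_reflection L).
Proof.
by rewrite filter_map; congr map; apply: eq_filter => r; exact: T_reflection_lconj.
Qed.

Lemma filter_T_inversions c : word_in (S `\` T) c ->
  seq.filter T_reflection (inversions c) = [::].
Proof.
elim: c => [//|s c IH] /word_in_cons[[Ss Ts] /IH {}IH] /=.
by rewrite filter_T_lconj IH; case: ifP => // /(T_reflectionP Ss).
Qed.

Lemma ST_involutions : involutions ST.
Proof.
move=> _ [t Tt [w _ <-]]; rewrite -[w * t * _]/(lconj w t) -lconjMr.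
by rewrite (invS (TS Tt)) /lconj mulg1 mulgV.
Qed.

Lemma retr_ST r : ST r -> f r = 1.
Proof.
move=> [t Tt [w _ <-]]; rewrite -[w * t * _]/(lconj w t) retr_lconj (fT Tt).
by rewrite /lconj mulg1 mulgV.
Qed.

Lemma retr_products h : products ST h -> f h = 1.
Proof.
move=> [b STb <-]; elim: b STb => [|r b IH]; first by rewrite wprod_nil retr1.
by move=> /word_in_cons[/retr_ST r1 /IH b1]; rewrite wprod_cons fM r1 b1 mulg1.
Qed.

Lemma sub_T_ST : T `<=` ST.
Proof.
move=> t Tt; exists t => //; exists 1; first exact: ((is_subgroupP U).1 sU).1.
by rewrite invg1 mulg1 mul1g.
Qed.

Lemma ST_lconj s r : (S `\` T) s -> ST r -> ST (lconj s r).
Proof.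
move=> STs [t Tt [w Uw <-]]; exists t => //; exists (s * w).
  apply: (subgroupM sU) => //; rewrite UE; exact: products_sub.
exact: lconjM.
Qed.

Lemma products_setT : products S = [set: W].
Proof. by rewrite -(range_word_value invS) cox.2.1. Qed.

(** Conjugation by an element of [S \ T] permutes [S_T], and [T] is contained in
   [S_T]; so the subgroup generated by [S_T] is normal. *)
Lemma normal_closureE : normal_closure (subgroup_gen T) = products ST.
Proof.
have sST := products_subgroup ST_involutions.
apply/seteqP; split.
  apply: smallest_sub; last first.
    apply: smallest_sub => // t Tt; exact/products_sub/sub_T_ST.
  split=> // x g xST; have : products S g by rewrite products_setT.
  move=> [c Sc <-]; elim: c Sc x xST => [|s c IH] Sc x xST.
    by rewrite wprod_nil conjg1.
  move: Sc => /word_in_cons[Ss Sc]; rewrite wprod_cons conjgM; apply: IH => //.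
  have ss := mulg1_eq (invS Ss).
  have [Ts|Ts] := pselect (T s).
    have sP : products ST s by exact/products_sub/sub_T_ST.
    rewrite conjgE ss; apply: subgroupM => //; exact: subgroupM.
  have {xST} [b STb <-] := xST; exists (map (lconj s) b).
    by move=> _ /mapP[r /STb STr ->]; exact: ST_lconj.
  elim: b {STb} => [|r b {}IH]; first by rewrite wprod_nil conj1g.
  by rewrite /= !wprod_cons IH conjMg /lconj (conjgE r) ss !mulgA.
move=> _ [b STb <-] M [[sM nM] TM]; apply: (subgroup_wprod sM _ STb).
move=> _ [t Tt [w _ <-]]; rewrite -[w in w * t]invgK -mulgA -conjgE.
by apply: nM; apply: TM; exact: sub_gen_smallest.
Qed.

(** Replace each letter [w t w^-1] by a word for [w] in [S \ T], the letter [t]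
   and the reversed word. The inversions at the letters of [w] are conjugates of
   elements of [S \ T], and the inversion at [t] is the inversion at
   [w t w^-1]. *)
Lemma spell_out b : word_in ST b -> exists a,
  [/\ word_in S a, wprod a = wprod b &
      inversions b = seq.filter T_reflection (inversions a)].
Proof.
elim: b => [|r b IH]; first by exists [::].
move=> /word_in_cons[[t Tt [w]]]; rewrite -/U UE => -[c cU cw] <-.
move=> /IH[a [Sa ab invE]]; have Sc : word_in S c by move=> s /cU[].
exists (c ++ t :: rev c ++ a); split.
- apply/word_in_cat; split=> //; apply/word_in_cons; split; first exact: TS.
  by apply/word_in_cat; split=> //; apply/word_in_rev.
- rewrite wprod_cat !wprod_cons wprod_cat (wprod_rev invS Sc) ab -cw.
  by rewrite !mulgA.
rewrite inversions_cat /= inversions_cat !filter_cat filter_T_inversions //=.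
rewrite T_reflection_lconj (T_reflectionP (TS Tt)).2 // -[RHS]/(_ :: _).
rewrite !filter_T_lconj filter_cat filter_T_lconj filter_T_inversions; last first.
  exact/word_in_rev.
rewrite /= (wprod_rev invS Sc) -invE cw -!map_comp; congr (_ :: _).
by apply: eq_map => x /=; rewrite -!lconjM.
Qed.

Lemma ST_even_inversions : even_inversions ST.
Proof.
move=> b /spell_out[a [Sa ab ->]] b1 r; rewrite b1 in ab.
rewrite count_filter; have [rT|rT] := boolP (T_reflection r).
  rewrite (eq_count (a2 := pred1 r)); first exact: evenS.
  by move=> s /=; case: eqP => // ->.
rewrite (eq_count (a2 := pred0)) ?count_pred0 // => s /=.
by case: eqP => // ->; exact: negbTE.
Qed.

Lemma ST_coxeter : exists mT, coxeter_system (products ST) ST mT.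
Proof.
apply: coxeter_system_of_even_inversions.
- exact: ST_involutions.
- exact: ST_even_inversions.
- exact/range_word_value/ST_involutions.
Qed.

(** Each letter [t] of [a] in [T] becomes [u t u^-1], where [u] is the product of
   the preceding letters of [a] in [S \ T]. *)
Lemma project_word (I : Type) (phi phiT : W -> I) a :
  extends_by_conjugation S T phi phiT -> word_in S a -> exists b u,
  [/\ word_in ST b, U u, wprod a = wprod b * u,
      inversions b = seq.filter T_reflection (inversions a) &
      map phiT b = map phi (seq.filter T_reflection a)].
Proof.
move=> ext; elim/last_ind: a => [|a s IH].
  move=> _; exists [::], 1; split; rewrite ?wprod_nil ?mulg1 //.
  exact: ((is_subgroupP U).1 sU).1.
rewrite -cats1 => /word_in_cat[/IH[b [u [STb Uu ab invE phiE]]]].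
move=> /word_in_cons[Ss _]; rewrite cats1 inversions_rcons !filter_rcons.
rewrite T_reflection_lconj -(cats1 a s) wprod_cat wprod_seq1 ab.
have [|/negP] := boolP (T_reflection s); last first.
  move=> sT; exists b, (u * s); split=> //; last by rewrite mulgA.
  apply: (subgroupM sU) => //; rewrite UE; apply: products_sub; split=> //.
  by move=> /(T_reflectionP Ss).
move=> /(T_reflectionP Ss) Ts; exists (rcons b (lconj u s)), u.
split=> //.
- rewrite -cats1; apply/word_in_cat; split=> //; apply/word_in_cons; split=> //.
  by exists s => //; exists u.
- by rewrite -cats1 wprod_cat wprod_seq1 /lconj !mulgA mulgVK.
- by rewrite inversions_rcons invE -lconjM.
- by rewrite !map_rcons phiE ext.
Qed.

(** If [w t w^-1 = w' t' w'^-1], then [t] and [t'] are conjugate in [W]. *)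
Lemma extension_exists (I : Type) (phi : W -> I) : allowable [set: W] S phi ->
  exists phiT, extends_by_conjugation S T phi phiT.
Proof.
move=> phiP; pose Q r i := exists t w, [/\ T t, U w, r = lconj w t & i = phi t].
have /choice[phiT phiTP] r : exists i, (exists j, Q r j) -> Q r i.
  have [[j Qj]|nQ] := pselect (exists j, Q r j); first by exists j.
  by exists (phi r) => /nQ.
exists phiT => t w Tt Uw.
have [|t' [w' [Tt' Uw' tE ->]]] := phiTP (w * t * w^-1).
  by exists (phi t), t, w.
apply: phiP; [exact: TS|exact: TS|exists (w'^-1 * w) => //].
by rewrite conjg_lconj invgM invgK lconjM -[lconj w' t']tE lconjK.
Qed.

Lemma extension_allowable (I : Type) (phi phiT : W -> I) H :
  allowable [set: W] S phi -> extends_by_conjugation S T phi phiT ->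
  allowable H ST phiT.
Proof.
move=> phiP ext _ _ [t Tt [w Uw <-]] [t' Tt' [w' Uw' <-]] [g _ tE].
rewrite !ext //; apply: phiP; [exact: TS|exact: TS|exists (w^-1 * g * w') => //].
have {}tE : lconj w' t' = lconj w t ^ g := tE.
by rewrite !conjgM !conjg_lconj in tE *; rewrite invgK -tE lconjK.
Qed.

(** * Comparison of the growth series *)

Section Growth.
Variables (I : choiceType) (phi phiT : W -> I) (x0 : I).
Hypotheses (finS : finite_set S) (finU : finite_set U).
Hypothesis phiP : allowable [set: W] S phi.
Hypothesis phi_x0 : S `&` phi @^-1` [set x0] = S `\` T.
Hypothesis ext : extends_by_conjugation S T phi phiT.

Let sT : is_subgroup [set: W].
Proof. exact/is_subgroupP. Qed.

Lemma ST_finite : finite_set ST.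
Proof.
apply: (sub_finite_set _ (finite_image2 (fun t w => w * t * w^-1)
  (sub_finite_set TS finS) finU)).
by move=> _ [t Tt [w Uw <-]]; exists t => //; exists w.
Qed.

Lemma decomposition w : exists h u, [/\ products ST h, U u & w = h * u].
Proof.
have [a Sa <-] : products S w by rewrite products_setT.
have [b [u [STb Uu -> _ _]]] := project_word ext Sa.
by exists (wprod b), u; split=> //; exists b.
Qed.

(** The retraction recovers [u] from [h * u]. *)
Lemma decomposition_unique h u h' u' : products ST h -> products ST h' ->
  U u -> U u' -> h * u = h' * u' -> h = h' /\ u = u'.
Proof.
move=> Ph Ph' Uu Uu' hu; have uu' : u = u'.
  have := congr1 f hu; rewrite !fM (retr_products Ph) (retr_products Ph').
  by rewrite !mul1g !retrU.
by split=> //; move: hu; rewrite uu' => /mulIg.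
Qed.

(** A reduced word [a] of [h * u] projects to a word [b] of [h] whose inversions
   are among those of [a], hence pairwise distinct. The monomials of [h * u] and
   [h] are thus those of [a] and [b], and the letters of [b] have the weights of
   the letters of [a] in [T]; the other letters of [a] have weight [x0]. *)
Lemma monomial_split h u : products ST h -> U u ->
  monomial_of ST phiT h x0 = 0%N /\
  forall x, x != x0 -> monomial_of S phi (h * u) x = monomial_of ST phiT h x.
Proof.
move=> Ph Uu.
have [|a ared] := @reduced_word_exists W S (h * u); first by rewrite products_setT.
have ua := uniq_inversions invS ared; have [[Sa aw] _] := ared.
have [b [v [STb Uv ab invE phiE]]] := project_word ext Sa.
have [] := @decomposition_unique (wprod b) v h u _ Ph Uv Uu.
- by exists b.
- by rewrite -ab.
move=> bh _.
have ub : uniq (inversions b) by rewrite invE filter_uniq.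
have STP : forall s, ST s -> products ST s by exact: products_sub.
rewrite -aw -/(wprod a) -bh (monomial_ofE invS evenS sT _ phiP Sa ua) //.
rewrite (monomial_ofE ST_involutions ST_even_inversions
  (products_subgroup ST_involutions) STP (extension_allowable phiP ext) STb ub).
have cntE x : word_monomial phiT b x =
    count (predI (fun s => phi s == x) T_reflection) a.
  rewrite word_monomialE -(count_filter (fun s => phi s == x)).
  rewrite -[LHS](count_map phiT (pred1 x)) -[RHS](count_map phi (pred1 x)).
  by rewrite phiE.
have phiS s : S s -> (phi s == x0) = ~~ T_reflection s.
  move=> Ss; have := congr1 (fun A : set W => A s) phi_x0.
  rewrite /setI /setD /= propeqE => eqs.
  apply/eqP/idP => [sx0|sT'].
    by apply/negP => /(T_reflectionP Ss); case: (eqs.1 (conj Ss sx0)).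
  have [] // := eqs.2 (conj Ss _) => Ts.
  by move/negP: sT'; apply; apply/T_reflectionP.
split=> [|x xx0].
  rewrite cntE -(count_pred0 a); apply: eq_in_count => s /Sa Ss /=.
  by rewrite phiS // andNb.
rewrite cntE word_monomialE; apply: eq_in_count => s /Sa Ss /=.
case: eqP => //= sx; have := phiS s Ss; rewrite sx (negbTE xx0).
by move/esym/negbFE.
Qed.

Section Coefficient.
Variable J : {cmonom I}.
Hypothesis J0 : J x0 = 0%N.

(** The elements whose monomial becomes [J] after the substitution [x0 = 1]. *)
Definition fiber : set W :=
  [set w | forall x, x != x0 -> monomial_of S phi w x = J x].

Definition T_fiber : set W :=
  [set h | products ST h /\ monomial_of ST phiT h = J].

Lemma T_fiber_finite : finite_set T_fiber.
Proof.
apply: finite_monomial_fiber => //.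
- exact: ST_involutions.
- exact: ST_even_inversions.
- exact/products_subgroup/ST_involutions.
- exact: extension_allowable phiP ext.
- exact: ST_finite.
Qed.

Lemma fiberE : fiber = (fun p => p.1 * p.2) @` (T_fiber `*` U).
Proof.
apply/seteqP; split=> [w wJ|_ [[h u] [[Ph hJ] Uu] <-] x xx0 /=]; last first.
  by rewrite (monomial_split Ph Uu).2 // hJ.
have [h [u [Ph Uu wE]]] := decomposition w; exists (h, u) => //; split=> //=.
split=> //; have [m0 mE] := monomial_split Ph Uu.
apply/eqP/cmP => x; have [->|xx0] := eqVneq x x0; first by rewrite m0 J0.
by rewrite -mE // -wE wJ.
Qed.

Lemma fiber_finite : finite_set fiber.
Proof.
by rewrite fiberE; apply/finite_image; exact: finite_setX T_fiber_finite finU.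
Qed.

Lemma card_fiber :
  #|` fset_set fiber| = (#|` fset_set U| * #|` fset_set T_fiber|)%N.
Proof.
have finT := T_fiber_finite.
rewrite mulnC -(size_allpairs (fun h u => h * u)); apply: perm_size.
apply: uniq_perm => [||w]; first exact: fset_uniq.
  apply: allpairs_uniq; rewrite ?fset_uniq // => -[h u] [h' u'].
  move=> /allpairsP[[h1 u1] [/= + + [-> ->]]]; rewrite !in_fset_set //.
  move=> /set_mem[Ph _] /set_mem Uu.
  move=> /allpairsP[[h2 u2] [/= + + [-> ->]]]; rewrite !in_fset_set //.
  move=> /set_mem[Ph' _] /set_mem Uu' hu.
  by have [-> ->] := decomposition_unique Ph Ph' Uu Uu' hu.
rewrite in_fset_set ?fiberE; last by rewrite -fiberE; exact: fiber_finite.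
apply/idP/allpairsP => [/set_mem[[h u] [Th Uu] <-]|[[h u] [/= hT uU ->]]].
  by exists (h, u); rewrite !in_fset_set //; split=> //; exact/mem_set.
move: hT uU; rewrite !in_fset_set // => /set_mem hT /set_mem uU.
by apply/mem_set; exists (h, u).
Qed.

Lemma in_fiber w n :
  (monomial_of S phi w == mmul J (expcmn (ucm x0) n)) =
  (w \in fset_set fiber) && (n == monomial_of S phi w x0).
Proof.
rewrite in_fset_set; last exact: fiber_finite.
apply/eqP/andP => [wJ|[/set_mem wJ /eqP ->]].
  split; [apply/mem_set => x xx0|]; rewrite wJ cmM expcmnE ucmE ?eqxx.
    by rewrite eq_sym (negbTE xx0) muln0 addn0.
  by rewrite J0 muln1.
apply/eqP/cmP => x; rewrite cmM expcmnE ucmE eq_sym.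
by case: eqVneq => [->|/wJ ->]; rewrite ?J0 ?muln1 ?muln0 ?addn0.
Qed.

Lemma growth_seriesE n :
  growth_series [set: W] S phi (mmul J (expcmn (ucm x0) n)) =
  (\sum_(w <- fset_set fiber) ((n == monomial_of S phi w x0)%:R : int))%R.
Proof.
rewrite /growth_series (fsbigTE (fset_set fiber)) => [|w wF]; last first.
  by rewrite in_fiber (negbTE wF).
by apply: eq_big_seq => w wF; rewrite in_fiber wF.
Qed.

Definition x0_degrees : {fset nat} :=
  [fset monomial_of S phi w x0 | w in fset_set fiber]%fset.

Lemma growth_series_eq0 n : n \notin x0_degrees ->
  growth_series [set: W] S phi (mmul J (expcmn (ucm x0) n)) = 0%R.
Proof.
move=> nD; rewrite growth_seriesE big_seq big1 // => w wF.
by case: eqP nD => // -> /negP[]; exact: in_imfset.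
Qed.

Lemma sum_growth_series :
  (\sum_(n \in [set: nat])
    growth_series [set: W] S phi (mmul J (expcmn (ucm x0) n)) =
  #|` fset_set fiber|%:R)%R.
Proof.
rewrite (fsbigTE x0_degrees) => [|n]; last exact: growth_series_eq0.
under eq_bigr do rewrite growth_seriesE.
rewrite exchange_big /= big_seq.
rewrite (eq_bigr (fun=> (1%:R)%R)) => [|w wF].
  by rewrite -big_seq -GRing.natr_sum sum1_size.
have wD : monomial_of S phi w x0 \in x0_degrees by exact: in_imfset.
rewrite (bigD1_seq _ wD (fset_uniq _)) /= eqxx.
by rewrite big1 ?GRing.addr0 // => n /negbTE ->.
Qed.

Lemma T_growth_seriesE :
  growth_series (products ST) ST phiT J = (#|` fset_set T_fiber|%:R)%R.
Proof.
have TF h : (h \in fset_set T_fiber) = (h \in T_fiber).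
  by rewrite in_fset_set //; exact: T_fiber_finite.
rewrite /growth_series (fsbigE (fset_set T_fiber)) ?fset_uniq //.
- rewrite big_seq_cond (eq_bigr (fun=> (1%:R)%R)) => [|h]; last first.
    by rewrite TF => /andP[/set_mem[_ ->]]; rewrite eqxx.
  rewrite (eq_bigl (fun h => h \in fset_set T_fiber)) => [|h].
    by rewrite -big_seq -GRing.natr_sum sum1_size.
  rewrite TF; apply/andb_idr => /set_mem[Ph _]; exact/mem_set.
- by move=> h /=; rewrite TF => /set_mem[].
- move=> h Ph; rewrite TF => hF; case: eqP => // hJ.
  by case/negP: hF; apply/mem_set.
Qed.

End Coefficient.

Lemma growth_series_evaluable : evaluable_at1 x0 (growth_series [set: W] S phi).
Proof.
move=> J J0; apply: (sub_finite_set _ (finite_fset (x0_degrees J))) => n /=.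
by apply: contraR => nD; rewrite growth_series_eq0.
Qed.

(** For [J] free of [x0], both coefficients count the fiber of [J]; for the other
   [J], none of the generators in [S_T] has weight [x0]. *)
Lemma growth_series_at1 : eval_at1 x0 (growth_series [set: W] S phi) =
  (#|` fset_set U|%:Z \*o growth_series (products ST) ST phiT)%R.
Proof.
apply/funext => J; rewrite /eval_at1 /=; case: eqP => [J0|J0].
  by rewrite sum_growth_series // T_growth_seriesE card_fiber // GRing.natrM !natz.
rewrite /growth_series fsbig1 ?GRing.mulr0 // => h Ph; case: eqP => // hJ; case: J0.
have U1 := ((is_subgroupP U).1 sU).1.
by rewrite -hJ (monomial_split Ph U1).1.
Qed.

End Growth.
End Retraction.

Theorem theorem4p4 (W : groupType) (S : set W) (m : W -> W -> option nat)
    (T : set W) (I : choiceType) (phi : W -> I) (x0 : I)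
    (coxWS : coxeter_system [set: W] S m)
    (finS : finite_set S)
    (subTS : T `<=` S)
    (even_m : forall t s, T t -> (S `\` T) s -> even_or_infinite (m s t))
    (finWST : finite_set (subgroup_gen (S `\` T)))
    (allow_phi : allowable [set: W] S phi)
    (phi_x0 : S `&` phi @^-1` [set x0] = S `\` T) :
  let WT := normal_closure (subgroup_gen T) in
  let ST := conj_generators S T in
  [/\ exists mT : W -> W -> option nat, coxeter_system WT ST mT,
      exists phiT : W -> I, extends_by_conjugation S T phi phiT,
      evaluable_at1 x0 (growth_series [set: W] S phi) &
      forall phiT : W -> I, extends_by_conjugation S T phi phiT ->
        allowable WT ST phiT /\
        eval_at1 x0 (growth_series [set: W] S phi) =
        (#|` fset_set (subgroup_gen (S `\` T))|)%:Z \*o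
          growth_series WT ST phiT].
Proof.
move=> WT ST; have [f [fM fT fST]] := retraction_exists coxWS subTS even_m.
have [phiT ext] := extension_exists subTS allow_phi.
rewrite /WT (normal_closureE coxWS subTS); split.
- exact: (ST_coxeter coxWS subTS fM fT fST).
- by exists phiT.
- exact: (growth_series_evaluable coxWS subTS fM fT fST finS finWST allow_phi
    phi_x0 ext).
move=> psi psi_ext; split; first exact: (extension_allowable subTS allow_phi psi_ext).
exact: (growth_series_at1 coxWS subTS fM fT fST finS finWST allow_phi phi_x0
  psi_ext).
Qed.
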